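(* For $\alpha>0$ and $n\ge1$ let $B=B(n,\alpha)$ be the $n\times n$ matrix with entries $$b_{i,j}=\begin{cases}\alpha/n,& i\ne j,\\ 1,& i=j.\end{cases}$$ There exist constants $\alpha_0,\beta>0$ such that if $0<\alpha<\alpha_0$ then $$\liminf_{n\to\infty}\frac1n\left|\mathbb{E}\log\det(B_{1/2}\odot G)^2-\log\mathbb{E}\det(B_{1/2}\odot G)^2\right|\ge\beta.$$
   Context: $B_{1/2}$ is the entrywise square root of $B$, $\odot$ is the Hadamard (entrywise) product, $G$ is the $n\times n$ standard Gaussian matrix (i.i.d. $N(0,1)$ entries), and $\det(M)^2=(\det M)^2$. *)

(* Defs.v *)
From HB Require Import structures.
From mathcomp Require Import all_boot all_order all_algebra.
From mathcomp Require Import all_classical all_reals all_analysis.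

Set Implicit Arguments.
Unset Strict Implicit.
Unset Printing Implicit Defensive.
Import Order.TTheory GRing.Theory Num.Theory.

Local Open Scope classical_set_scope.
Local Open Scope ring_scope.

(* Mutual independence of a finite family of real random variables: the
   product rule for every finite subfamily and all choices of Borel sets. *)
Definition mutually_independent (R : realType) (d : measure_display)
    (T : measurableType d) (P : probability T R) (I : finType)
    (X : I -> {RV P >-> R}) : Prop :=
  forall (J : {set I}) (A : I -> set R),
    (forall i, i \in J -> measurable (A i)) ->
    P (\bigcap_(i in [set i | i \in J]) (X i @^-1` A i)) =
    (\prod_(i in J) P (X i @^-1` A i))%E.

(* A random matrix is given by the family of its entries; the second parameter
   of [normal_prob] is the standard deviation. *)
Definition standard_gaussian_matrix (R : realType) (d : measure_display)
    (T : measurableType d) (P : probability T R) (n : nat)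
    (G : 'I_n -> 'I_n -> {RV P >-> R}) : Prop :=
  (forall (i j : 'I_n) (A : set R), measurable A ->
     distribution P (G i j) A = normal_prob 0 1 A) /\
  mutually_independent (fun ij : 'I_n * 'I_n => G ij.1 ij.2).

Definition sample_mx (R : realType) (d : measure_display)
    (T : measurableType d) (P : probability T R) (n : nat)
    (G : 'I_n -> 'I_n -> {RV P >-> R}) (w : T) : 'M[R]_n :=
  \matrix_(i, j) G i j w.

Definition hadamard_mx (R : realType) (m n : nat) (A B : 'M[R]_(m, n)) :
  'M[R]_(m, n) := map2_mx *%R A B.

Definition mx_sqrt (R : realType) (m n : nat) (A : 'M[R]_(m, n)) :
  'M[R]_(m, n) := map_mx Num.sqrt A.

Definition B_mx (R : realType) (n : nat) (alpha : R) : 'M[R]_n :=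
  \matrix_(i, j) if i == j then 1 else alpha / n%:R.

Section DetSquare.
Variables (R : realType) (d : measure_display) (T : measurableType d).
Variables (P : probability T R) (n : nat).
Variables (B : 'M[R]_n) (G : 'I_n -> 'I_n -> {RV P >-> R}).

Definition det2 (w : T) : R :=
  (\det (hadamard_mx (mx_sqrt B) (sample_mx G w))) ^+ 2.

(* The logarithm is the extended one, with [lne 0 = -oo], so the expectation is
   that of an extended real function, which ['E_P[_]] does not cover. *)
Definition expect_log_det2 : \bar R := (\int[P]_w lne (det2 w)%:E)%E.

Definition log_expect_det2 : \bar R := lne ('E_P[det2])%E.

End DetSquare.

(* Main.v *)
(* Let [g_i] be the diagonal Gaussians and [s = E g^2].  Expanding the square of
   the determinant, all cross terms vanish, so [E det^2] is a permanent, at least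
   [s^n] by its identity term.  For the logarithm, tilt by a weight [exp (u g)]
   that doubles when [g] is small, which happens with probability [p]: pointwise
     [log det^2 <= det^2 * prod_i exp (u g_i) - 1 - sum_i u g_i].
   The expectation of the weighted square is again a permanent, bounded by the
   product of its row sums; [u] is shifted so that these are at most 1.  As
   [g^2 <= s / 4] on the small set, for small alpha the doubling increases the
   row sums by a factor of about [1 + p / 4] only, whereas it adds
   [p * ln 2 >= p / 2] to [E (u g)].
   Hence [E log det^2 <= n (ln s - p / 8)]. *)

Require Import Defs.
From HB Require Import structures.
From mathcomp Require Import all_boot all_order all_algebra.
From mathcomp Require Import fingroup perm.
From mathcomp Require Import all_classical all_reals all_analysis.
From mathcomp Require Import measurable_realfun.
From mathcomp Require Import ring lra.

Set Implicit Arguments.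
Unset Strict Implicit.
Unset Printing Implicit Defensive.
Import Order.TTheory GRing.Theory Num.Theory.

Local Open Scope classical_set_scope.
Local Open Scope ring_scope.

(** * Change of variables for a measure given by a weighted image *)

Section weighted_image.
Import HBNNSimple.

(** The hypothesis on [nu] is the case of indicators; linearity gives simple functions and monotone
    convergence the rest. It serves twice: with [X] a random variable and [g] a product of functions
    of the others, and with [X] the identity and [g] a normal density. *)
Lemma ge0_integral_weighted_image d1 d2 (T1 : measurableType d1)
    (T2 : measurableType d2) (R : realType) (mu : {measure set T1 -> \bar R})
    (nu : {measure set T2 -> \bar R}) (X : T1 -> T2) (g : T1 -> R)
    (f : T2 -> R) :
    measurable_fun [set: T1] X -> measurable_fun [set: T1] g ->
    (forall x, 0 <= g x) ->
    (forall A, measurable A -> nu A = \int[mu]_x (\1_A (X x) * g x)%:E)%E ->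
    measurable_fun [set: T2] f -> (forall y, 0 <= f y) ->
  (\int[nu]_y (f y)%:E = \int[mu]_x (f (X x) * g x)%:E)%E.
Proof.
move=> mX mg g0 nuE mf f0.
have mEf : measurable_fun [set: T2] (fun y => (f y)%:E).
  exact/measurable_EFinP.
have Ef0 y : [set: T2] y -> (0 <= (f y)%:E)%E by rewrite lee_fin.
pose h := nnsfun_approx measurableT mEf.
have mhX n : measurable_fun [set: T1] (h n \o X).
  by apply: measurableT_comp => //; exact/measurable_funP.
have ndh y : {homo (fun n => h n y) : m n / (m <= n)%N >-> m <= n}.
  by move=> m n mn; exact/lefP/nd_nnsfun_approx.
transitivity (limn (fun n => \int[nu]_y (h n y)%:E))%E.
  rewrite -monotone_convergence//.
  - apply: eq_integral => y _; apply/esym/cvg_lim => //.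
    exact: (cvg_nnsfun_approx _ _ Ef0).
  - by move=> n; exact/measurable_EFinP/measurable_funP.
  - by move=> n y _; rewrite lee_fin.
  - by move=> y _ m n mn; rewrite lee_fin ndh.
transitivity (limn (fun n => \int[mu]_x (h n (X x) * g x)%:E))%E; last first.
  rewrite -monotone_convergence//.
  - apply: eq_integral => x _; apply/cvg_lim => //.
    under eq_fun do rewrite EFinM.
    rewrite EFinM; apply: cvgeZr => //.
    exact: (cvg_nnsfun_approx _ _ Ef0).
  - by move=> n; apply/measurable_EFinP; exact: (measurable_funM (mhX n) mg).
  - by move=> n x _; rewrite lee_fin mulr_ge0.
  - by move=> x _ m n mn; rewrite lee_fin ler_wpM2r// ndh.
congr (limn _); apply/funext => n.
under eq_integral do rewrite fimfunE -fsumEFin//.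
under [RHS]eq_integral => x _.
  rewrite fimfunE mulr_fsuml -fsumEFin//; over.
have mr (r : R) : measurable (h n @^-1` [set r]) by [].
have ind_ge0 r y : 0 <= r * \1_(h n @^-1` [set r]) y.
  by rewrite -lee_fin; exact: nnfun_muleindic_ge0.
have mind r :
    measurable_fun [set: T1] (fun x => \1_(h n @^-1` [set r]) (X x) : R).
  by apply: (measurableT_comp (measurable_indic (mr r)) mX).
rewrite !ge0_integral_fsum//=; last 4 first.
- move=> r; apply/measurable_EFinP; apply: measurable_funM => //.
  exact: measurable_funM.
- by move=> r x _; rewrite lee_fin mulr_ge0.
- by move=> r; apply/measurable_EFinP; exact: measurable_funM.
- by move=> r x _; rewrite lee_fin.
apply: eq_fsbigr => r /[!inE] -[z _ <-].
under eq_integral do rewrite EFinM.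
under [RHS]eq_integral do rewrite -mulrA EFinM.
rewrite !ge0_integralZl//; last 5 first.
- by apply/measurable_EFinP; exact: measurable_funM.
- by move=> x _; rewrite lee_fin mulr_ge0.
- by rewrite lee_fin.
- exact/measurable_EFinP/measurable_indic.
- by rewrite lee_fin.
by congr (_ * _)%E; rewrite integral_indic// setIT nuE.
Qed.

End weighted_image.

(** * Expectation of products of independent variables *)

Section independence.
Context d (T : measurableType d) (R : realType) (P : probability T R).
Context (I : finType) (X : I -> {RV P >-> R}).
Hypothesis indepX : mutually_independent X.

Let measurable_prodX (f : I -> R -> R) (D : pred I) :
  (forall i, measurable_fun [set: R] (f i)) ->
  measurable_fun [set: T] (fun w => \prod_(i | D i) f i (X i w)).
Proof.
move=> mf; rewrite [X in measurable_fun _ X](_ : _ =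
  fun w => \prod_(i <- enum D) f i (X i w)); last first.
  by apply/funext => w; rewrite big_enum.
by apply: measurable_prod => i _; exact: measurableT_comp.
Qed.

(* [J] is the set of indices where [f] is not yet known to be an indicator. *)
Let ge0_integral_prod_indep_aux (J : {set I}) (f : I -> R -> R) (m : I -> R) :
    (forall i, i \notin J -> exists2 A, measurable A & f i = \1_A) ->
    (forall i, measurable_fun [set: R] (f i)) ->
    (forall i x, 0 <= f i x) ->
    (forall i, \int[P]_w (f i (X i w))%:E = (m i)%:E)%E ->
  (\int[P]_w (\prod_i f i (X i w))%:E = (\prod_i m i)%:E)%E.
Proof.
have [n] := ubnP #|J|; elim: n J f m => // n IHn J f m.
rewrite ltnS => leJn fJ mf f0 fm.
have m0 i : 0 <= m i.
  by rewrite -lee_fin -fm; apply: integral_ge0 => w _; rewrite lee_fin.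
have [J0|[i iJ]] := set_0Vmem J.
  (* Base case: every factor is an indicator, so the product is the indicator of an intersection and
     the product rule for events applies. *)
  have /choice[A fA] : forall i, exists A : set R, measurable A /\ f i = \1_A.
    by move=> i; have [|A mA ->] := fJ i; [rewrite J0 finset.in_set0|exists A].
  have mXA i : measurable (X i @^-1` A i).
    by rewrite -[_ @^-1` _]setTI; apply: measurable_funP => //; have [] := fA i.
  have mE i : P (X i @^-1` A i) = (m i)%:E.
    have [mA fiA] := fA i.
    rewrite -fm -[in LHS](setIT (X i @^-1` A i)) -integral_indic//.
    by apply: eq_integral => w _; rewrite fiA.
  transitivity
    (P (\bigcap_(i in [set i | i \in [set: I]%SET]) (X i @^-1` A i))).
    rewrite -[X in P X]setIT -integral_indic//; last first.
      by apply: fin_bigcap_measurable => // ; exact: finite_finset.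
    apply: eq_integral => w _; congr _%:E; rewrite indicE.
    have [wA|wA] := boolP (w \in _).
      rewrite big1// => i _; have [_ ->] := fA i.
      rewrite indicE mem_set//; move/set_mem: wA; apply.
      by rewrite /= finset.in_setT.
    have [i nA] : exists i, ~ (X i @^-1` A i) w.
      apply: contrapT => /forallNP hA; move/negP: wA; apply.
      apply/mem_set => i _.
      exact: contrapT.
    rewrite (bigD1 i)//=; have [_ ->] := fA i.
    by rewrite indicE memNset// mul0r.
  rewrite indepX => [|i _]; last by have [] := fA i.
  rewrite -prodEFin; apply: eq_big => i; first by rewrite finset.in_setT.
  by rewrite mE.
(* Induction step: the measure sending [A] to the expectation of [\1_A (X i)] times the other
   factors is [c] times the law of [X i]; integrating [f i] against it gives the claim. On each [A]
   this is the induction hypothesis with [f i] replaced by [\1_A], which removes [i] from [J]. *)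
pose c := \prod_(j | j != i) m j.
have c0 : 0 <= c by exact: prodr_ge0.
pose g w := \prod_(j | j != i) f j (X j w).
have mg : measurable_fun [set: T] g by exact: measurable_prodX.
have g0 w : 0 <= g w by exact: prodr_ge0.
under eq_integral do rewrite (bigD1 i)//=.
rewrite -(@ge0_integral_weighted_image _ _ _ _ _ _
  (mscale (NngNum c0) (distribution P (X i))) (X i) g (f i))//.
  rewrite ge0_integral_mscale//=; last 2 first.
  - exact/measurable_EFinP.
  - by move=> x _; rewrite lee_fin.
  rewrite ge0_integral_distribution//; last 2 first.
  - exact/measurable_EFinP.
  - by move=> x; rewrite lee_fin.
  by rewrite fm -EFinM (bigD1 i)//= mulrC.
move=> A mA; rewrite /mscale/=.
pose f' j := if j == i then \1_A else f j.
pose m' j := if j == i then fine (distribution P (X i) A) else m j.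
have f'j j : j != i -> f' j = f j by rewrite /f' => /negbTE ->.
have m'j j : j != i -> m' j = m j by rewrite /m' => /negbTE ->.
have : (\int[P]_w (\prod_j f' j (X j w))%:E = (\prod_j m' j)%:E)%E.
  apply: (IHn (J :\ i)%SET).
  - by rewrite (leq_trans _ leJn)// [ltnRHS](cardsD1 i) iJ.
  - move=> j; rewrite in_setD1 negb_and negbK.
    have [-> _|ji /= jJ] := eqVneq j i.
      by exists A => //; rewrite /f' eqxx.
    by have [B mB fB] := fJ j jJ; exists B => //; rewrite f'j.
  - move=> j; have [->|ji] := eqVneq j i; last by rewrite f'j.
    by rewrite /f' eqxx; exact: measurable_indic.
  - by move=> j x; rewrite /f'; case: ifP.
  - move=> j; have [->|ji] := eqVneq j i; last by rewrite f'j// m'j.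
    rewrite /f' /m' eqxx fineK ?fin_num_measure//.
    rewrite -[A in RHS]setIT -integral_indic//.
    rewrite ge0_integral_distribution//.
    exact/measurable_EFinP/measurable_indic.
rewrite (bigD1 i)//= {1}/m' eqxx (eq_bigr m) => [|j /m'j//].
rewrite EFinM fineK ?fin_num_measure// muleC => cE.
apply: etrans (esym cE) _; apply: eq_integral => w _.
rewrite (bigD1 i)//= {1}/f' eqxx.
by congr (_ * _)%:E; apply: eq_bigr => j /f'j ->.
Qed.

(** The nonnegative product formula, applied to the absolute values of the factors, shows that the
    absolute moment is finite. *)
Lemma integrable_prod_indep (f : I -> R -> R) :
    (forall i, measurable_fun [set: R] (f i)) ->
    (forall i, P.-integrable [set: T] (fun w => (f i (X i w))%:E)) ->
  P.-integrable [set: T] (fun w => (\prod_i f i (X i w))%:E).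
Proof.
move=> mf fX; apply/integrableP; split.
  by apply/measurable_EFinP; exact: measurable_prodX.
under eq_integral do rewrite abse_EFin normr_prod.
rewrite (ge0_integral_prod_indep_aux (J := [set: I]%SET)
  (f := fun i x => `|f i x|)
  (m := fun i => fine (\int[P]_w `|f i (X i w)|%:E))) ?ltry//.
- by move=> i; rewrite finset.in_setT.
- by move=> i; exact: measurableT_comp.
- move=> i; rewrite fineK// integrable_fin_num//.
  exact: (integrable_abse (fX i)).
Qed.

(** Signs are removed one factor at a time by writing [f i] as the difference of the nonnegative
    functions [|f i|] and [|f i| - f i]. *)
Lemma integral_prod_indep (f : I -> R -> R) (m : I -> R) :
    (forall i, measurable_fun [set: R] (f i)) ->
    (forall i, P.-integrable [set: T] (fun w => (f i (X i w))%:E)) ->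
    (forall i, \int[P]_w (f i (X i w))%:E = (m i)%:E)%E ->
  (\int[P]_w (\prod_i f i (X i w))%:E = (\prod_i m i)%:E)%E.
Proof.
move=> mf fX fm.
(* Here [J] contains every index whose factor may take negative values; the induction is on its
   cardinality. *)
suff: forall J : {set I}, (forall i x, i \notin J -> 0 <= f i x) ->
    (\int[P]_w (\prod_i f i (X i w))%:E = (\prod_i m i)%:E)%E.
  by move/(_ [set: I]%SET); apply => i x; rewrite finset.in_setT.
move=> J; have [n] := ubnP #|J|; elim: n J f m mf fX fm => // n IHn.
move=> J f m mf fX fm; rewrite ltnS => leJn f0.
have [J0|[i iJ]] := set_0Vmem J.
  (* All factors are now nonnegative, but none is known to be an indicator, so the auxiliary lemma
     starts from the full index set. *)
  apply: (ge0_integral_prod_indep_aux (J := [set: I]%SET)) => // i.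
    by rewrite finset.in_setT.
  by move=> x; rewrite f0// J0 finset.in_set0.
pose upd (T' : Type) (h : I -> T') u j := if j == i then u else h j.
have updi (T' : Type) (h : I -> T') u : upd T' h u i = u by rewrite /upd eqxx.
have updN (T' : Type) (h : I -> T') u j : j != i -> upd T' h u j = h j.
  by rewrite /upd => /negbTE ->.
have prod_upd (S : comPzRingType) (h : I -> S) u :
    \prod_j upd S h u j = u * \prod_(j | j != i) h j.
  rewrite (bigD1 i)//= updi; congr (_ * _).
  by apply: eq_bigr => j ji; rewrite updN.
have prod_updX w u : \prod_j upd (R -> R) f u j (X j w) =
    u (X i w) * \prod_(j | j != i) f j (X j w).
  rewrite (bigD1 i)//= updi; congr (_ * _).
  by apply: eq_bigr => j ji; rewrite updN.
(* Replacing [f i] by a nonnegative [u] takes [i] out of [J], so the induction hypothesis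
   applies. *)
have step (u : R -> R) (a : R) : measurable_fun [set: R] u ->
    P.-integrable [set: T] (fun w => (u (X i w))%:E) ->
    (\int[P]_w (u (X i w))%:E = a%:E)%E -> (forall x, 0 <= u x) ->
    P.-integrable [set: T]
      (fun w => (u (X i w) * \prod_(j | j != i) f j (X j w))%:E) /\
    (\int[P]_w (u (X i w) * \prod_(j | j != i) f j (X j w))%:E =
      (a * \prod_(j | j != i) m j)%:E)%E.
  move=> mu iu ua u0.
  have mf' j : measurable_fun [set: R] (upd _ f u j).
    by have [->|ji] := eqVneq j i; [rewrite updi|rewrite updN].
  have fX' j : P.-integrable [set: T] (fun w => (upd _ f u j (X j w))%:E).
    by have [->|ji] := eqVneq j i; [rewrite updi|rewrite updN].
  have fm' j : (\int[P]_w (upd _ f u j (X j w))%:E = (upd _ m a j)%:E)%E.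
    by have [->|ji] := eqVneq j i; [rewrite !updi|rewrite !updN].
  have := integrable_prod_indep mf' fX'.
  under eq_fun do rewrite prod_updX.
  split=> //; rewrite -prod_upd -(IHn (J :\ i)%SET _ _ mf' fX' fm').
  - by apply: eq_integral => w _; rewrite prod_updX.
  - by rewrite (leq_trans _ leJn)// [ltnRHS](cardsD1 i) iJ.
  - move=> j x; rewrite in_setD1 negb_and negbK.
    have [-> _|ji /= jJ] := eqVneq j i; first by rewrite updi.
    by rewrite updN// f0.
pose b := fine (\int[P]_w `|f i (X i w)|%:E).
have iabs : P.-integrable [set: T] (fun w => (`|f i (X i w)|)%:E).
  exact: (integrable_abse (fX i)).
have bE : (\int[P]_w `|f i (X i w)|%:E = b%:E)%E.
  by rewrite fineK// integrable_fin_num.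
have [i1 e1] := step (fun x => `|f i x|) b
  (measurableT_comp (@normr_measurable R setT) (mf i)) iabs bE
  (fun x => normr_ge0 _).
have [||||i2 e2] := step (fun x => `|f i x| - f i x) (b - m i).
- by apply: measurable_funB => //; exact: measurableT_comp.
- by under eq_fun do rewrite EFinB; exact: integrableB.
- by under eq_integral do rewrite EFinB; rewrite integralB// bE fm.
- by move=> x; rewrite subr_ge0 ler_norm.
transitivity (\int[P]_w ((`|f i (X i w)| * \prod_(j | j != i) f j (X j w))%:E -
  ((`|f i (X i w)| - f i (X i w)) * \prod_(j | j != i) f j (X j w))%:E))%E.
  apply: eq_integral => w _; rewrite -EFinB -mulrBl subKr.
  by rewrite (bigD1 i).
rewrite integralB// e1 e2 -EFinB -mulrBl subKr.
by rewrite [in RHS](bigD1 i).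
Qed.

End independence.

(** * The standard normal law: positivity on intervals, symmetry, moments *)

Section standard_normal.
Context {R : realType}.
Local Notation mu := (@lebesgue_measure R).
Local Notation N := (@normal_prob R 0 1).

Let measurable_EFin_normal_pdf (m s : R) (A : set R) :
  measurable_fun A (fun x : R => (normal_pdf m s x)%:E).
Proof.
apply/measurable_EFinP; apply: measurable_funTS.
exact: measurable_normal_pdf.
Qed.

Lemma ge0_integral_normal_prob (m s : R) (f : R -> R) :
    measurable_fun [set: R] f -> (forall x, 0 <= f x) ->
  (\int[normal_prob m s]_x (f x)%:E =
   \int[mu]_x (f x * normal_pdf m s x)%:E)%E.
Proof.
move=> mf f0; apply: (@ge0_integral_weighted_image _ _ _ _ _ mu _ idfun) => //.
- exact: measurable_id.
- exact: measurable_normal_pdf.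
- exact: normal_pdf_ge0.
- move=> A mA; transitivity (\int[mu]_(x in A) (normal_pdf m s x)%:E)%E => //.
  rewrite [LHS]integral_mkcond; apply: eq_integral => x _.
  rewrite patchE indicE.
  by case: ifP; rewrite ?mul1r ?mul0r.
Qed.

Lemma normal_prob_itvcc_gt0 (a b : R) : a < b -> (0 < N `[a, b])%E.
Proof.
(* [c] bounds the density from below on the interval, where [x ^+ 2 <= a ^+ 2 + b ^+ 2]. *)
move=> ab; pose c := normal_peak 1 * expR (- (a ^+ 2 + b ^+ 2) / 2) : R.
have c0 : 0 < c by rewrite mulr_gt0 ?expR_gt0 ?normal_peak_gt0.
apply: (@lt_le_trans _ _ (\int[mu]_(x in `[a, b]) c%:E)%E).
  rewrite integral_cst//= lebesgue_measure_itv/= lte_fin ab -EFinD -EFinM.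
  rewrite lte_fin.
  by rewrite mulr_gt0// subr_gt0.
apply: ge0_le_integral => //=.
- by move=> x _; rewrite lee_fin ltW.
- exact: measurable_EFin_normal_pdf.
- move=> x; rewrite in_itv/= => /andP[ax xb].
  rewrite lee_fin normal_pdfE ?oner_eq0// ler_wpM2l ?normal_peak_ge0//.
  rewrite /normal_fun ler_expR subr0 expr1n ler_wpM2r ?invr_ge0//.
  rewrite lerN2; have [x0|x0] := leP 0 x.
    by rewrite -[leLHS]add0r lerD ?sqr_ge0// ler_sqr ?nnegrE//; lra.
  by rewrite -[leLHS]addr0 lerD ?sqr_ge0//; nra.
Qed.

(** Lebesgue measure and the density are both invariant under negation. *)
Lemma normal_prob_oppr (A : set R) : measurable A -> N (-%R @^-1` A) = N A.
Proof.
move=> mA; rewrite /normal_prob.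
have mpdf : measurable_fun A (fun x : R => (normal_pdf 0 1 x)%:E).
  exact: measurable_EFin_normal_pdf.
transitivity (\int[pushforward mu (-%R : R -> measurableTypeR R)]_(x in A)
    (normal_pdf 0 1 x)%:E)%E; last first.
  by apply: eq_measure_integral => B mB _; exact: lebesgue_measureN.
rewrite ge0_integral_pushforward//=; last first.
  by move=> x _; rewrite lee_fin normal_pdf_ge0.
apply: eq_integral => x _; congr _%:E.
by rewrite !normal_pdfE ?oner_eq0// /normal_fun !subr0 sqrrN.
Qed.

Let integral_normal_prob_sqr_lty :
  (\int[N]_x (x ^+ 2)%:E < +oo)%E.
Proof.
rewrite ge0_integral_normal_prob//; last by move=> x; exact: sqr_ge0.
(* Since [x^2 / 4 <= exp (x^2 / 4)], one has [x^2 exp (- x^2 / 2) <= 4 exp (- x^2 / 4)]. The right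
   side is proportional to the centred normal density of variance 2, and [c] collects the
   constants. *)
pose s : R := Num.sqrt 2.
have s0 : s != 0 by rewrite sqrtr_eq0 -ltNge.
pose c : R := 4 * normal_peak 1 / normal_peak s.
have c0 : 0 <= c by rewrite !mulr_ge0 ?invr_ge0 ?normal_peak_ge0.
apply: (@le_lt_trans _ _ (\int[mu]_x (c%:E * (normal_pdf 0 s x)%:E))%E).
  apply: ge0_le_integral => //.
  - by move=> x _; rewrite lee_fin mulr_ge0 ?sqr_ge0 ?normal_pdf_ge0.
  - apply/measurable_EFinP/measurable_funM; last exact: measurable_normal_pdf.
    exact: measurable_funX.
  - apply/measurable_EFinP/measurable_funM => //; exact: measurable_normal_pdf.
  - move=> x _; rewrite -EFinM lee_fin !normal_pdfE ?oner_eq0//.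
    rewrite (_ : c * _ = normal_peak 1 * (4 * normal_fun 0 s x)); last first.
      by rewrite /c; field; rewrite gt_eqF// normal_peak_gt0.
    rewrite mulrCA ler_wpM2l ?normal_peak_ge0//.
    rewrite /normal_fun !subr0 sqr_sqrtr// expr1n.
    rewrite (_ : - x ^+ 2 / (1 *+ 2) =
      - x ^+ 2 / (2 *+ 2) + - (x ^+ 2 / 4)); last by field.
    rewrite expRD mulrCA mulrC ler_wpM2r ?expR_ge0//.
    rewrite expRN ler_pdivrMr ?expR_gt0// mulrC -ler_pdivrMr//.
    by apply: le_trans (expR_ge1Dx _); rewrite lerDr.
rewrite ge0_integralZl//; last 2 first.
- exact: measurable_EFin_normal_pdf.
- by move=> x _; rewrite lee_fin normal_pdf_ge0.
by rewrite integral_normal_pdf mule1 ltry.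
Qed.

(** Domination using the finite second moment. It covers the identity, the square, indicators and
    the factors contributed by single matrix entries. *)
Lemma integrable_normal_prob_quadratic (c : R) (f : R -> R) :
    measurable_fun [set: R] f -> (forall x, `|f x| <= c * (1 + x ^+ 2)) ->
  (N : {measure set _ -> \bar R}).-integrable [set: R] (fun x => (f x)%:E).
Proof.
move=> mf fc; have c0 : 0 <= c.
  by have := le_trans (normr_ge0 _) (fc 0); rewrite expr0n addr0 mulr1.
have msqr : measurable_fun [set: R] (fun x : R => x ^+ 2).
  exact: measurable_funX.
have isqr : (N : {measure set _ -> \bar R}).-integrable [set: R]
    (fun x => (x ^+ 2)%:E).
  apply/integrableP; split; first exact/measurable_EFinP.
  by under eq_integral do rewrite abse_EFin ger0_norm ?sqr_ge0//.
have ig : (N : {measure set _ -> \bar R}).-integrable [set: R]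
    (fun x => c%:E * (1%:E + (x ^+ 2)%:E))%E.
  apply: integrableZl => //; apply: integrableD => //.
  exact: finite_measure_integrable_cst.
apply: (le_integrable measurableT _ _ ig); first exact/measurable_EFinP.
move=> x _; rewrite lee_fin.
by rewrite (le_trans (fc x))// ler_norm.
Qed.

Lemma integrable_normal_prob_sqr :
  (N : {measure set _ -> \bar R}).-integrable [set: R]
    (fun x => (x ^+ 2)%:E).
Proof.
apply: (integrable_normal_prob_quadratic (c := 1)) => [|x].
  exact: measurable_funX.
by rewrite mul1r ger0_norm ?sqr_ge0// lerDr.
Qed.

(** By symmetry of the law, the mean is finite and equal to its own opposite. *)
Lemma integral_normal_prob_id : (\int[N]_x x%:E = 0)%E.
Proof.
have ix : (N : {measure set _ -> \bar R}).-integrable [set: R] (fun x => x%:E).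
  apply: (integrable_normal_prob_quadratic (c := 1)).
    exact: measurable_id.
  move=> x; rewrite mul1r; have := sqr_ge0 (`|x| - 1).
  by rewrite sqrrB real_normK ?num_real//; nra.
have NE : (\int[N]_x x%:E = - \int[N]_x x%:E)%E.
  transitivity (\int[pushforward N (-%R : R -> measurableTypeR R)]_x x%:E)%E.
    by apply: eq_measure_integral => A mA _; rewrite -[LHS]normal_prob_oppr.
  rewrite integral_pushforward//=.
  - rewrite preimage_setT; under eq_integral do rewrite EFinN.
    by rewrite integralN// integrable_add_def.
  - by rewrite preimage_setT; exact: (integrableN ix).
have fx : (\int[N]_x (x : R)%:E)%E \is a fin_num by exact: integrable_fin_num.
move: NE; rewrite -(fineK fx) -EFinN => -[e].
by congr _%:E; lra.
Qed.

End standard_normal.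

(** Expanding the product of the row sums gives one term for each map from rows to columns. The
    permanent is the part over injective maps, and the remaining terms are nonnegative. *)
Lemma sum_perm_prod_le (R : numDomainType) (n : nat) (c : 'I_n -> 'I_n -> R) :
    (forall i j, 0 <= c i j) ->
  \sum_(s : 'S_n) \prod_i c i (s i) <= \prod_i \sum_j c i j.
Proof.
move=> c0; rewrite bigA_distr_bigA/=.
rewrite (bigID (fun f : {ffun _} => injectiveb f))/=.
rewrite -[leLHS]addr0 lerD//; last by apply: sumr_ge0 => f _; exact: prodr_ge0.
rewrite [leRHS](reindex (@pval _))/=; last first.
  exists (insubd (1%g : 'S_n)) => /= f Uf; last by apply: insubdK.
  by apply: val_inj; apply: insubdK.
rewrite [leRHS](eq_bigl xpredT) => [|s]; last by rewrite (valP s).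
by rewrite ler_sum// => s _; rewrite pvalE.
Qed.

(** * Transfer of integrals from the normal law to a random variable *)

Section standard_normal_variable.
Context d (T : measurableType d) (R : realType) (P : probability T R).
Variable X : {RV P >-> R}.
Hypothesis lawX : forall A, measurable A ->
  distribution P X A = normal_prob 0 1 A.
Local Notation N := (@normal_prob R 0 1).

(* [normal_prob] is a measure on [measurableTypeR R], whose display differs from
   the one of the codomain of [X]. *)
Let mX : measurable_fun [set: T] (X : T -> measurableTypeR R).
Proof. exact: (measurable_funP X). Qed.

Lemma ge0_integral_normal_RV (f : R -> R) :
    measurable_fun [set: R] f -> (forall x, 0 <= f x) ->
  (\int[P]_w (f (X w))%:E = \int[N]_x (f x)%:E)%E.
Proof.
move=> mf f0.
transitivity (\int[pushforward P (X : T -> measurableTypeR R)]_x (f x)%:E)%E.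
  rewrite ge0_integral_pushforward//; first exact/measurable_EFinP.
  by move=> x _; rewrite lee_fin.
by apply: eq_measure_integral => A mA _; exact: lawX.
Qed.

Lemma integrable_normal_RV (f : R -> R) :
    measurable_fun [set: R] f ->
    (N : {measure set _ -> \bar R}).-integrable [set: R] (fun x => (f x)%:E) ->
  P.-integrable [set: T] (fun w => (f (X w))%:E).
Proof.
move=> mf /integrableP[_ fN]; apply/integrableP; split.
  by apply/measurable_EFinP; exact: measurableT_comp.
rewrite (ge0_integral_normal_RV (f := fun x => `|f x|))//.
exact: measurableT_comp.
Qed.

Lemma integral_normal_RV (f : R -> R) :
    measurable_fun [set: R] f ->
    (N : {measure set _ -> \bar R}).-integrable [set: R] (fun x => (f x)%:E) ->
  (\int[P]_w (f (X w))%:E = \int[N]_x (f x)%:E)%E.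
Proof.
move=> mf fN.
transitivity (\int[pushforward P (X : T -> measurableTypeR R)]_x (f x)%:E)%E.
  rewrite integral_pushforward//; first exact/measurable_EFinP.
  exact: integrable_normal_RV.
by apply: eq_measure_integral => A mA _; exact: lawX.
Qed.

End standard_normal_variable.

(** * Second moment of the determinant, weighted along the diagonal *)

Section weighted_det_moment.
Context d (T : measurableType d) (R : realType) (P : probability T R) (n : nat).
Variables (G : 'I_n -> 'I_n -> {RV P >-> R}) (B : 'M[R]_n).
Hypothesis gaussG : standard_gaussian_matrix G.
Hypothesis B0 : forall i j, 0 <= B i j.
Variables (v : R -> R) (c s a b : R).
Hypothesis mv : measurable_fun [set: R] v.
Hypothesis vc : forall x, 0 <= v x <= c.
Local Notation N := (@normal_prob R 0 1).
Hypothesis intsqr : (\int[N]_x (x ^+ 2)%:E = s%:E)%E.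
Hypothesis intv : (\int[N]_x (v x)%:E = a%:E)%E.
Hypothesis intsqrv : (\int[N]_x (x ^+ 2 * v x)%:E = b%:E)%E.

(** The factor that entry [ij] contributes to the [(p, q)] term of the weighted squared determinant.
    Taking the product over all positions, most with exponent zero, puts each term in the form to
    which independence of the entries applies. *)
Let f (p q : 'S_n) (ij : 'I_n * 'I_n) (x : R) : R :=
  x ^+ ((p ij.1 == ij.2) + (q ij.1 == ij.2)) *
  (if ij.1 == ij.2 then v x else 1).

Let coef (p : 'S_n) : R := (-1) ^+ p * \prod_i Num.sqrt (B i (p i)).

Let prod_pow (p : 'S_n) w :
  \prod_ij (G ij.1 ij.2 w) ^+ (p ij.1 == ij.2) = \prod_i G i (p i) w.
Proof.
rewrite -(pair_bigA _ (fun i j => G i j w ^+ (p i == j)))/=.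
apply: eq_bigr => i _; rewrite (bigD1 (p i))//= eqxx expr1 big1 ?mulr1// => j.
by rewrite eq_sym => /negbTE ->; rewrite expr0.
Qed.

Let det2_expand w :
  det2 B G w * \prod_i v (G i i w) =
  \sum_(p : 'S_n) \sum_(q : 'S_n)
    coef p * coef q * \prod_ij f p q ij (G ij.1 ij.2 w).
Proof.
have prodf p q : \prod_ij f p q ij (G ij.1 ij.2 w) =
    (\prod_i G i (p i) w) * (\prod_i G i (q i) w) * \prod_i v (G i i w).
  rewrite -!prod_pow -big_split/= big_split/=; congr (_ * _).
    by apply: eq_bigr => ij _; rewrite exprD.
  rewrite -(pair_bigA _ (fun i j => if i == j then v (G i j w) else 1))/=.
  apply: eq_bigr => i _; rewrite (bigD1 i)//= eqxx big1 ?mulr1// => j.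
  by rewrite eq_sym => /negbTE ->.
have detE : \det (hadamard_mx (mx_sqrt B) (sample_mx G w)) =
    \sum_(p : 'S_n) coef p * \prod_i G i (p i) w.
  apply: eq_bigr => p _; rewrite -mulrA -big_split/=; congr (_ * _).
  by apply: eq_bigr => i _; rewrite !mxE.
rewrite /det2 detE expr2 big_distrlr/= mulr_suml; apply: eq_bigr => p _.
rewrite mulr_suml; apply: eq_bigr => q _; rewrite prodf; ring.
Qed.

Let c_ge0 : 0 <= c.
Proof. by have /andP[h1 h2] := vc 0; exact: le_trans h2. Qed.

Let mf p q ij : measurable_fun [set: R] (f p q ij).
Proof.
apply: measurable_funM; first exact: measurable_funX.
by case: (ij.1 == ij.2).
Qed.

Let fN p q ij :
  (N : {measure set _ -> \bar R}).-integrable [set: R]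
    (fun x => (f p q ij x)%:E).
Proof.
(* The power of [x] has exponent at most two, and [c + 1] bounds both [v x] and the off-diagonal
   weight 1. *)
apply: (integrable_normal_prob_quadratic (c := c + 1)) => // x.
rewrite normrM mulrC ler_pM//.
  case: ifP => _; last by rewrite normr1 lerDr.
  by have /andP[h1 h2] := vc x; rewrite ger0_norm// (le_trans h2)// lerDl.
have x2 := sqr_ge0 x.
case: (p ij.1 == ij.2); case: (q ij.1 == ij.2) => /=.
- by rewrite ger0_norm// lerDr.
- by rewrite addn0 expr1 ler_norml; apply/andP; split; nra.
- by rewrite add0n expr1 ler_norml; apply/andP; split; nra.
- by rewrite expr0 normr1 lerDl.
Qed.

Let m p q ij : R := fine (\int[N]_x (f p q ij x)%:E)%E.

Let mE p q ij (r : R) :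
  (\int[N]_x (f p q ij x)%:E = r%:E)%E -> m p q ij = r.
Proof. by rewrite /m => ->. Qed.

Let law i j A : measurable A -> distribution P (G i j) A = normal_prob 0 1 A.
Proof. by move=> mA; have [+ _] := gaussG; exact. Qed.

Let integrable_term p q : P.-integrable [set: T]
  (fun w => (\prod_ij f p q ij (G ij.1 ij.2 w))%:E).
Proof.
apply: (@integrable_prod_indep _ _ _ _ _ (fun ij => G ij.1 ij.2)) => //.
  by have [] := gaussG.
by move=> ij; apply: integrable_normal_RV => //; exact: law.
Qed.

Let integral_term p q :
  (\int[P]_w (\prod_ij f p q ij (G ij.1 ij.2 w))%:E = (\prod_ij m p q ij)%:E)%E.
Proof.
apply: (@integral_prod_indep _ _ _ _ _ (fun ij => G ij.1 ij.2)) => //.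
- by have [] := gaussG.
- by move=> ij; apply: integrable_normal_RV => //; exact: law.
- move=> ij; rewrite (integral_normal_RV (@law ij.1 ij.2))//.
  by rewrite /m fineK// integrable_fin_num.
Qed.

(* If [p i != q i], one of the two is an off-diagonal entry of row [i] that
   occurs with exponent one, and the Gaussian has mean zero. *)
Let prod_m_neq p q : p != q -> \prod_ij m p q ij = 0.
Proof.
move=> pq; have [i pqi] : exists i, p i != q i.
  apply/existsP; apply: contraNT pq; rewrite negb_exists => /forallP h.
  by apply/eqP/permP => i; have := h i; rewrite negbK => /eqP.
suff [j mj] : exists j, m p q (i, j) = 0 by rewrite (bigD1 (i, j))//= mj mul0r.
have [pii|pii] := eqVneq i (p i).
  exists (q i); apply: mE.
  rewrite /f/= eqxx (negbTE pqi) add0n {1}pii (negbTE pqi).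
  by under eq_integral do rewrite expr1 mulr1; exact: integral_normal_prob_id.
exists (p i); apply: mE; rewrite /f/= eqxx eq_sym in pqi *.
rewrite (negbTE pqi) addn0 (negbTE pii).
by under eq_integral do rewrite expr1 mulr1; exact: integral_normal_prob_id.
Qed.

(** Row by row: if [p] fixes [i], the diagonal entry carries both the square and the weight, giving
    [b]. Otherwise the diagonal carries the weight alone, giving [a], and entry [(i, p i)] the
    square alone, giving [s]. All other entries contribute 1. *)
Let prod_m_eq p : \prod_ij m p p ij = \prod_i (if p i == i then b else a * s).
Proof.
rewrite -(pair_bigA _ (fun i j => m p p (i, j)))/=.
apply: eq_bigr => i _; rewrite (bigD1 i)//=.
have [pii|pii] := eqVneq (p i) i.
  rewrite big1 ?mulr1 => [|j ji]; last first.
    apply: mE; rewrite /f/= pii ![_ == j]eq_sym (negbTE ji).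
    under eq_integral do rewrite expr0 mulr1.
    by rewrite integral_cst//= probability_setT mule1.
  by apply: mE; rewrite /f/= pii eqxx.
rewrite (bigD1 (p i))//= big1 ?mulr1 => [|j /andP[ji jpi]]; last first.
  apply: mE; rewrite /f/= ![_ == j]eq_sym (negbTE ji) (negbTE jpi).
  under eq_integral do rewrite expr0 mulr1.
  by rewrite integral_cst//= probability_setT mule1.
congr (_ * _); apply: mE; rewrite /f/=.
  rewrite (negbTE pii) eqxx.
  by under eq_integral do rewrite expr0 mul1r.
rewrite eqxx eq_sym (negbTE pii).
by under eq_integral do rewrite mulr1.
Qed.

Let coef_sqr p : coef p * coef p = \prod_i B i (p i).
Proof.
rewrite /coef mulrACA -expr2 sqrr_sign mul1r -big_split/=.
by apply: eq_bigr => i _; rewrite -expr2 sqr_sqrtr.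
Qed.

Let integrable_coef_term p q : P.-integrable [set: T] (fun w =>
  (coef p * coef q * \prod_ij f p q ij (G ij.1 ij.2 w))%:E).
Proof.
under eq_fun do rewrite EFinM.
by apply: integrableZl => //; exact: integrable_term.
Qed.

Lemma integrable_weighted_det2 : P.-integrable [set: T]
  (fun w => (det2 B G w * \prod_i v (G i i w))%:E).
Proof.
under eq_fun do rewrite det2_expand -sumEFin.
apply: integrable_sum => // p _; under eq_fun do rewrite -sumEFin.
by apply: integrable_sum => // q _; exact: integrable_coef_term.
Qed.

(** In the double sum over permutations only [p = q] survives, where signs cancel and the square
    roots of entries of [B] are squared. It is used with [v = exp u] for the upper bound and with
    [v = 1] for the lower one. *)
Lemma integral_weighted_det2 :
  (\int[P]_w (det2 B G w * \prod_i v (G i i w))%:E =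
   (\sum_(p : 'S_n) \prod_i (B i (p i) * if p i == i then b else a * s))%:E)%E.
Proof.
under eq_integral do rewrite det2_expand -sumEFin.
rewrite integral_sum//=; last first.
  move=> p; under eq_fun do rewrite -sumEFin.
  by apply: integrable_sum => // q _; exact: integrable_coef_term.
rewrite -sumEFin; apply: eq_bigr => p _.
under eq_integral do rewrite -sumEFin.
rewrite integral_sum//=.
have term q : (\int[P]_w (coef p * coef q *
    \prod_ij f p q ij (G ij.1 ij.2 w))%:E =
    (coef p * coef q * \prod_ij m p q ij)%:E)%E.
  under eq_integral do rewrite EFinM.
  by rewrite integralZl//= integral_term.
rewrite (bigD1 p)//= big1 ?adde0 => [|q qp].
  by rewrite term coef_sqr prod_m_eq -big_split.
by rewrite term prod_m_neq ?mulr0// eq_sym.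
Qed.

End weighted_det_moment.

(** * Bounds on the expected logarithm and on the logarithm of the expectation *)

Section log_det_bounds.
Context d (T : measurableType d) (R : realType) (P : probability T R) (n : nat).
Variables (G : 'I_n -> 'I_n -> {RV P >-> R}) (B : 'M[R]_n).
Hypothesis gaussG : standard_gaussian_matrix G.
Hypothesis B0 : forall i j, 0 <= B i j.
Local Notation N := (@normal_prob R 0 1).
Variable s : R.
Hypothesis intsqr : (\int[N]_x (x ^+ 2)%:E = s%:E)%E.

Let measurable_lne_det2 :
  measurable_fun [set: T] (fun w => lne (det2 B G w)%:E).
Proof.
have mdet2 : measurable_fun [set: T] (det2 B G).
  apply: measurable_funX; apply: measurable_sum => p.
  apply: measurable_funM => //.
  apply: measurable_prod => i _; under eq_fun do rewrite !mxE.
  exact: measurable_funM.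
apply: measurable_fun_ifT => //; first exact: measurable_fun_ler.
by apply/measurable_EFinP; exact: measurableT_comp.
Qed.

(* [log y <= y exp S - 1 - S] for every [S]; here [S] is the sum of
   [u (G i i)], and the row sum hypothesis makes [E (y exp S) <= 1]. *)
Lemma expect_log_det2_le (u : R -> R) (c l a b : R) :
    measurable_fun [set: R] u -> (forall x, u x <= c) ->
    (N : {measure set _ -> \bar R}).-integrable [set: R] (fun x => (u x)%:E) ->
    (\int[N]_x (u x)%:E = l%:E)%E ->
    (\int[N]_x (expR (u x))%:E = a%:E)%E ->
    (\int[N]_x (x ^+ 2 * expR (u x))%:E = b%:E)%E ->
    (forall i, \sum_j B i j * (if j == i then b else a * s) <= 1) ->
  (expect_log_det2 B G <= (- (l *+ n))%:E)%E.
Proof.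
move=> mu uc iu ul ea eb rows.
have law i A : measurable A -> distribution P (G i i) A = normal_prob 0 1 A.
  by move=> mA; have [+ _] := gaussG; exact.
have iuG i : P.-integrable [set: T] (fun w => (u (G i i w))%:E).
  by apply: integrable_normal_RV => //; exact: law.
have mexpu : measurable_fun [set: R] (fun x => expR (u x)).
  exact: measurableT_comp.
have expc x : 0 <= expR (u x) <= expR c by rewrite expR_ge0 ler_expR uc.
have a0 : 0 <= a.
  by rewrite -lee_fin -ea; apply: integral_ge0 => x _; rewrite lee_fin expR_ge0.
have s0 : 0 <= s.
  rewrite -lee_fin -intsqr; apply: integral_ge0 => x _.
  by rewrite lee_fin sqr_ge0.
have b0 : 0 <= b.
  rewrite -lee_fin -eb; apply: integral_ge0 => x _.
  by rewrite lee_fin mulr_ge0 ?sqr_ge0 ?expR_ge0.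
have iD := integrable_weighted_det2 B gaussG mexpu expc.
have eD := integral_weighted_det2 gaussG B0 mexpu expc intsqr ea eb.
pose D w := det2 B G w * \prod_i expR (u (G i i w)).
have D1 : (\int[P]_w (D w)%:E <= 1)%E.
  have F0 i j : 0 <= B i j * (if j == i then b else a * s).
    by rewrite mulr_ge0//; case: ifP => // _; rewrite mulr_ge0.
  rewrite eD lee_fin (le_trans (sum_perm_prod_le F0))//.
  apply: (@le_trans _ _ (\prod_(i < n) 1)); last by rewrite big1_eq.
  by apply: ler_prod => i _; rewrite rows sumr_ge0.
pose S w : \bar R := (\sum_i (u (G i i w))%:E)%E.
have iS : P.-integrable [set: T] S by exact: integrable_sum.
have i1 : P.-integrable [set: T] (fun=> 1%E).
  exact: finite_measure_integrable_cst.
have iD1 : P.-integrable [set: T] (fun w => (D w)%:E - 1)%E.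
  exact: integrableB.
pose h w : \bar R := ((D w)%:E - 1 - S w)%E.
have ih : P.-integrable [set: T] h by exact: integrableB.
have hE : (\int[P]_w h w <= (- (l *+ n))%:E)%E.
  rewrite integralB// integralB//= integral_sum//=.
  rewrite integral_cst//= probability_setT mule1.
  rewrite (eq_bigr (fun=> l%:E)) => [|i _]; last first.
    by rewrite (integral_normal_RV (@law i))//.
  rewrite sumEFin sumr_const card_ord EFinN.
  by rewrite -[leRHS]add0e leeB// sube_le0.
apply: le_trans hE.
(* A vanishing determinant gives [-oo] on the left. Otherwise write [ln y = ln (y exp z) - z] and
   use [ln (1 + x) <= x] with [x = y exp z - 1 > -1]. *)
have lneh w : (lne (det2 B G w)%:E <= h w)%E.
  rewrite /h /S sumEFin -!EFinB /=; case: ifPn => [_|]; first exact: leNye.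
  rewrite -ltNge lee_fin => y0.
  rewrite /D -expR_sum; set z := \sum_i _.
  have -> : ln (det2 B G w) = ln (1 + (det2 B G w * expR z - 1)) - z.
    by rewrite (addrC 1) subrK lnM ?posrE ?expR_gt0// expRK addrK.
  by rewrite lerB// le_ln1Dx// ltrBrDl addrN mulr_gt0 ?expR_gt0.
(* Integrability of the logarithm has not been established, so monotonicity is applied to the
   positive and negative parts separately. *)
rewrite /expect_log_det2 integralE [leRHS]integralE leeB//.
- apply: ge0_le_integral => //.
  + exact: measurable_funepos.
  + by apply: measurable_funepos; exact: measurable_int ih.
  + move=> w _; apply: (@funepos_le _ _ setT) => [z _|]; first exact: lneh.
    exact: mem_set.
- apply: ge0_le_integral => //.
  + by apply: measurable_funeneg; exact: measurable_int ih.
  + exact: measurable_funeneg.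
  + move=> w _; apply: (@funeneg_le _ _ setT) => [z _|]; first exact: lneh.
    exact: mem_set.
Qed.

Lemma log_expect_det2_ge : (forall i, B i i = 1) -> 0 < s ->
  ((ln s *+ n)%:E <= log_expect_det2 B G)%E.
Proof.
move=> Bd s0; rewrite /log_expect_det2 unlock.
(* The trivial weight [v = 1] has [a = 1] and [b = s]. *)
have e1 : (\int[N]_x 1%:E = 1%:E :> \bar R)%E.
  by rewrite integral_cst//= probability_setT mule1.
have es : (\int[N]_x (x ^+ 2 * 1)%:E = s%:E)%E.
  by under eq_integral do rewrite mulr1.
have le01 (x : R) : 0 <= cst (1 : R) x <= (1 : R) by rewrite /= ler01 lexx.
have := integral_weighted_det2 gaussG B0 (measurable_cst _) le01 intsqr e1 es.
under eq_integral do rewrite big1// mulr1.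
move=> ->; rewrite -lnXn//.
have sn : s ^+ n <= \sum_(p : 'S_n)
    \prod_i (B i (p i) * (if p i == i then s else 1 * s)).
  rewrite (bigD1 (1%g : 'S_n))//= [X in X + _](_ : _ = s ^+ n); last first.
    under eq_bigr do rewrite perm1 Bd mul1r eqxx.
    by rewrite prodr_const card_ord.
  rewrite lerDl sumr_ge0// => p _; rewrite prodr_ge0// => i _.
  by rewrite mul1r if_same mulr_ge0// ltW.
rewrite lne_EFin; last by rewrite (lt_le_trans _ sn)// exprn_gt0.
by rewrite lee_fin ler_ln ?posrE ?(lt_le_trans _ sn)// exprn_gt0.
Qed.

End log_det_bounds.

(** * Construction of the tilting weight *)

Section tilted_weight.
Context {R : realType}.
Local Notation N := (@normal_prob R 0 1).

(** Positivity holds because the square dominates the indicator of [[1, 2]], an interval of positive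
    mass. *)
Lemma normal_prob_sqr_fin :
  exists2 s : R, 0 < s & (\int[N]_x (x ^+ 2)%:E = s%:E)%E.
Proof.
have msqr : measurable_fun [set: R] (fun x : R => x ^+ 2).
  exact: measurable_funX.
have isqr := @integrable_normal_prob_sqr R.
exists (fine (\int[N]_x (x ^+ 2)%:E)%E); last first.
  by rewrite fineK// integrable_fin_num//.
rewrite -lte_fin fineK ?integrable_fin_num//.
apply: (lt_le_trans (normal_prob_itvcc_gt0 (ltr1n R 2))).
rewrite -[X in (N X <= _)%E]setIT -integral_indic//.
apply: ge0_le_integral => //=.
- exact/measurable_EFinP.
- exact/measurable_EFinP.
- move=> x _; rewrite lee_fin indicE.
  have [/set_mem|_] := boolP (x \in _); last exact: sqr_ge0.
  by rewrite /= in_itv/= => /andP[x1 _]; rewrite expr_ge1// (le_trans ler01).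
Qed.

(** The quantity [b + al * a * s] bounds every row sum of the tilted permanent: [b] comes from the
    diagonal, and the off-diagonal entries of a row of [B] add up to at most [al]. *)
Lemma exists_tilted_weight (s t p al : R) : 0 < s -> t ^+ 2 = s / 4 ->
    (\int[N]_x (x ^+ 2)%:E = s%:E)%E -> N `[- t, t] = p%:E -> 0 < al ->
  exists (u : R -> R) (c a b : R),
    [/\ measurable_fun [set: R] u, forall x, u x <= c,
        (N : {measure set _ -> \bar R}).-integrable [set: R]
          (fun x => (u x)%:E),
        (\int[N]_x (u x)%:E =
          (ln 2 * p - ln (s * (1 + p / 4 + al * (1 + p))))%:E)%E &
        [/\ (\int[N]_x (expR (u x))%:E = a%:E)%E,
            (\int[N]_x (x ^+ 2 * expR (u x))%:E = b%:E)%E,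
            0 <= a & b + al * a * s <= 1]].
Proof.
move=> s0 ts es ep al0; set K := s * _.
(* Thus [exp u] is [2 / K] on the small set and [1 / K] elsewhere. With [m0] the part of the second
   moment on the small set, the row bound becomes [(s + m0 + al (1 + p) s) / K], and [K] is chosen
   so that [m0 <= s p / 4] makes this at most 1. *)
pose u (x : R) := ln 2 * \1_`[- t, t] x - ln K.
have mA : measurable (`[- t, t] : set R) by exact: measurable_itv.
have p0 : 0 <= p by rewrite -lee_fin -ep.
have K0 : 0 < K by rewrite mulr_gt0// addr_gt0// ?mulr_gt0//; lra.
have mI : measurable_fun [set: R] (\1_`[- t, t] : R -> R).
  exact: measurable_indic.
have I01 x : 0 <= (\1_`[- t, t] x : R) <= 1.
  by rewrite indicE; case: (_ \in _); rewrite /= ?lexx ler01.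
have msqr : measurable_fun [set: R] (fun x : R => x ^+ 2).
  exact: measurable_funX.
have iI : (N : {measure set _ -> \bar R}).-integrable [set: R]
    (fun x => (\1_`[- t, t] x)%:E).
  apply: (integrable_normal_prob_quadratic (c := 1)) => // x.
  have /andP[h0 h1] := I01 x; have := sqr_ge0 x.
  by rewrite mul1r ger0_norm//; lra.
have isqr := @integrable_normal_prob_sqr R.
have isqrI : (N : {measure set _ -> \bar R}).-integrable [set: R]
    (fun x => (x ^+ 2 * \1_`[- t, t] x)%:E).
  apply: (integrable_normal_prob_quadratic (c := 1)).
    exact: measurable_funM.
  move=> x; have /andP[h0 h1] := I01 x.
  rewrite mul1r ger0_norm ?(mulr_ge0 (sqr_ge0 x))//.
  by rewrite (le_trans (ler_piMr (sqr_ge0 x) h1))// lerDr.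
have i1 r : (N : {measure set _ -> \bar R}).-integrable [set: R] (fun=> r%:E).
  exact: finite_measure_integrable_cst.
have eI : (\int[N]_x (\1_`[- t, t] x)%:E = p%:E)%E.
  by rewrite integral_indic// setIT.
have e1 r : (\int[N]_x r%:E = r%:E :> \bar R)%E.
  by rewrite integral_cst//= probability_setT mule1.
pose m0 := fine (\int[N]_x (x ^+ 2 * \1_`[- t, t] x)%:E)%E.
have em0 : (\int[N]_x (x ^+ 2 * \1_`[- t, t] x)%:E = m0%:E)%E.
  by rewrite fineK// integrable_fin_num//.
have m0p : m0 <= s / 4 * p.
  rewrite -lee_fin -em0 EFinM -eI -integralZl//.
  apply: le_integral => //; first exact: integrableZl.
  move=> x _; rewrite -EFinM lee_fin indicE.
  have [/set_mem|_] := boolP (x \in _); last by rewrite !mulr0.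
  by rewrite /= in_itv/= => /andP[x1 x2]; rewrite ler_wpM2r// -ts; nra.
have uE x : expR (u x) = K^-1 * (1 + \1_`[- t, t] x).
  rewrite /u expRD expRN lnK// mulrC; congr (_ * _).
  rewrite indicE; case: (_ \in _) => /=; last by rewrite mulr0 expR0 addr0.
  by rewrite mulr1 lnK// posrE.
exists u, (ln 2 - ln K), (K^-1 * (1 + p)), (K^-1 * (s + m0)); split.
- by apply: measurable_funB => //; exact: measurable_funM.
- move=> x; have /andP[_ h1] := I01 x.
  by rewrite lerB// ler_piMr// ln_ge0// ler1n.
- rewrite /u; under eq_fun do rewrite EFinB EFinM.
  by apply: integrableB => //; exact: integrableZl.
- rewrite /u; under eq_integral do rewrite EFinB EFinM.
  by rewrite integralB ?integralZl ?eI ?e1//; exact: integrableZl.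
split.
- under eq_integral do rewrite uE EFinM EFinD.
  rewrite integralZl//; last exact: integrableD.
  by rewrite integralD// e1 eI.
- under eq_integral do rewrite uE mulrCA mulrDr mulr1 EFinM EFinD.
  rewrite integralZl//; last exact: integrableD.
  by rewrite integralD// es em0.
- by rewrite mulr_ge0 ?invr_ge0 1?ltW// ltr_wpDr.
have -> : K^-1 * (s + m0) + al * (K^-1 * (1 + p)) * s =
    (s + m0 + al * (1 + p) * s) / K by ring.
by rewrite ler_pdivrMr// mul1r /K; nra.
Qed.

End tilted_weight.

(** * Choice of constants and the linear gap *)

Theorem lemma7p3 (R : realType) :
  exists alpha0 beta : R, [/\ 0 < alpha0, 0 < beta &
    forall alpha : R, 0 < alpha < alpha0 ->
    forall (d : nat -> measure_display)
      (T : forall n : nat, measurableType (d n))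
      (P : forall n : nat, probability (T n) R)
      (G : forall n : nat, 'I_n -> 'I_n -> {RV (P n) >-> R}),
    (forall n : nat, standard_gaussian_matrix (G n)) ->
    (beta%:E <= limn_einf (fun n : nat => (n%:R^-1)%:E *
       `| expect_log_det2 (B_mx n alpha) (G n)
          - log_expect_det2 (B_mx n alpha) (G n) |))%E].
Proof.
have [s s0 es] := normal_prob_sqr_fin (R := R).
(* With this [t], the small set, on which the square is at most [s / 4], is the interval from [- t]
   to [t]; [p] is its probability. *)
pose t := Num.sqrt s / 2.
have t0 : 0 < t by rewrite divr_gt0// sqrtr_gt0.
have tE : t ^+ 2 = s / 4.
  by rewrite expr_div_n sqr_sqrtr 1?ltW//; congr (_ / _); ring.
have Nt : (0 < @normal_prob R 0 1 `[(- t)%R, t])%E.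
  by apply: normal_prob_itvcc_gt0; lra.
pose p := fine (@normal_prob R 0 1 `[- t, t]).
have pE : @normal_prob R 0 1 `[- t, t] = p%:E.
  by rewrite fineK// fin_num_measure//; exact: measurable_itv.
have p0 : 0 < p by rewrite -lte_fin -pE.
have ple1 : p <= 1.
  by rewrite -lee_fin -pE probability_le1//; exact: measurable_itv.
(* The gain per row is at least [p / 2 - p / 4 - al (1 + p)]. As [p <= 1] and [al < p / 16], the
   last term is below [p / 8], which leaves [p / 8]. *)
exists (p / 16), (p / 8); split=> [||al /andP[al0 alp] d T P G gaussG].
- by rewrite divr_gt0.
- by rewrite divr_gt0.
rewrite limn_einf_lim; apply: lime_ge; first exact: is_cvg_einfs.
(* Only tails starting at 1 or later are bounded: the term at [n = 0] is 0, since [0^-1 = 0]. *)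
exists 1%N => // m /= m1; apply: le_ereal_inf_tmp => _ [n /= mn <-].
have n0 : (0 < n)%N by exact: leq_trans mn.
have nR0 : 0 < n%:R :> R by rewrite ltr0n.
have B0 i j : 0 <= B_mx n al i j.
  by rewrite mxE; case: ifP => // _; rewrite divr_ge0// ltW.
have [u [c [a [b [mu uc iu ul [ea eb a0 ab1]]]]]] :=
  exists_tilted_weight s0 tE es pE al0.
(* The [n - 1] off-diagonal entries [al / n] sum to at most [al]. *)
have rows i : \sum_j B_mx n al i j * (if j == i then b else a * s) <= 1.
  apply: le_trans ab1; rewrite (bigD1 i)//= mxE !eqxx mul1r lerD2l.
  rewrite (eq_bigr (fun=> al / n%:R * (a * s))) => [|j ji]; last first.
    by rewrite mxE eq_sym (negbTE ji).
  rewrite sumr_const cardC1 card_ord -[leLHS]mulr_natr.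
  rewrite [leLHS](_ : _ = al * a * s * (n.-1%:R / n%:R)); last by ring.
  rewrite ler_piMr//; first by rewrite !mulr_ge0// ltW.
  by rewrite ler_pdivrMr// mul1r ler_nat leq_pred.
have upper := expect_log_det2_le (gaussG n) B0 es mu uc iu ul ea eb rows.
have lower : ((ln s *+ n)%:E <= log_expect_det2 (B_mx n al) (G n))%E.
  by apply: (log_expect_det2_ge (gaussG n) B0 es) => // i; rewrite mxE eqxx.
have gap : - (ln 2 * p - ln (s * (1 + p / 4 + al * (1 + p)))) <= ln s - p / 8.
  (* This is [ln (1 + x) <= x] at [x = - 1 / 2]. *)
  have ln2 : 1 / 2 <= ln 2 :> R.
    have := @le_ln1Dx R (- (1 / 2)).
    rewrite (_ : 1 + - (1 / 2) = 2^-1); last by field.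
    by rewrite lnV ?posrE// lerN2; apply; lra.
  have y0 : 0 < p / 4 + al * (1 + p) by rewrite addr_gt0// ?mulr_gt0//; lra.
  rewrite -addrA lnM ?posrE//; last lra.
  have := @le_ln1Dx R (p / 4 + al * (1 + p)); nra.
have diff : (expect_log_det2 (B_mx n al) (G n) -
    log_expect_det2 (B_mx n al) (G n) <= (- (p / 8 *+ n))%:E)%E.
  apply: (le_trans (leeB upper lower)).
  rewrite -EFinB lee_fin -mulNrn -mulrnBl -mulNrn lerMn2r.
  by apply/orP; right; lra.
have absge : ((p / 8 *+ n)%:E <= `|expect_log_det2 (B_mx n al) (G n) -
    log_expect_det2 (B_mx n al) (G n)|)%E.
  by rewrite -abseN (le_trans _ (lee_abs _))// leeNr -EFinN.
apply: (@le_trans _ _ (n%:R^-1%:E * (p / 8 *+ n)%:E)%E); last first.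
  by apply: lee_wpmul2l => //; rewrite lee_fin invr_ge0.
by rewrite -EFinM lee_fin -[in leRHS](mulr_natl (p / 8)) mulKf// gt_eqF.
Qed.
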